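(* For every integer $k \geq 3$ and every real $\varepsilon > 0$, there exists an instance $\mathcal{I}_{k,\varepsilon}$ of Multiway Cut with $k$ terminals such that the integrality gap of the Călinescu–Karloff–Rabani (CKR) LP relaxation on $\mathcal{I}_{k,\varepsilon}$ is at least $\frac{6}{5 + \frac{1}{k-1}} - \varepsilon$.
   Context: Multiway Cut: given an undirected graph $G=(V,E)$ with nonnegative edge weights $w$ and terminals $t_1,\dots,t_k \in V$, find a partition of $V$ into $k$ parts, the $i$-th containing $t_i$, minimizing the total weight of edges whose endpoints lie in different parts. The CKR relaxation is: minimize $\sum_{e=(u,v)\in E} w(e)\cdot \frac12\|x^u - x^v\|_1$ subject to $x^u \in \Delta_k := \{x\in[0,1]^k : x_1+\dots+x_k = 1\}$ for all $u\in V$ and $x^{t_i} = e^i$ (the $i$-th standard basis vector) for all $i\in[k]=\{1,\dots,k\}$. The integrality gap of an instance is the ratio of its integral optimum to the optimum value of the CKR relaxation. *)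

(* Defs.v *)
From HB Require Import structures.
From mathcomp Require Import all_boot all_order all_algebra.
From mathcomp Require Import classical_sets reals.

Set Implicit Arguments.
Unset Strict Implicit.
Unset Printing Implicit Defensive.

Import Order.TTheory GRing.Theory Num.Theory.

Local Open Scope classical_set_scope.
Local Open Scope ring_scope.

(* Terminals must be pairwise distinct: otherwise no partition separates them. *)
Record multiway_cut (R : realType) (k : nat) := MultiwayCut {
  vertex : finType;
  edge : rel vertex;
  edge_sym : symmetric edge;
  edge_irrefl : irreflexive edge;
  weight : vertex -> vertex -> R;
  weight_sym : forall u v, weight u v = weight v u;
  weight_ge0 : forall u v, edge u v -> 0 <= weight u v;
  terminal : 'I_k -> vertex;
  terminal_inj : injective terminal
}.

Section MultiwayCut.
Variables (R : realType) (k : nat) (I : multiway_cut R k).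

Local Notation V := (vertex I).

(* Each undirected edge {u, v} is listed once, as the pair whose first
   component comes first in the enumeration of the vertices. *)
Definition edges : {set V * V} :=
  [set e : V * V | edge e.1 e.2 && (enum_rank e.1 < enum_rank e.2)%N]%SET.

(* A partition of V into k parts, the i-th one containing the i-th terminal,
   is encoded by the function that maps each vertex to the index of its part. *)
Definition is_multiway_partition (P : {ffun V -> 'I_k}) : Prop :=
  forall i, P (terminal I i) = i.

Definition cut_cost (P : {ffun V -> 'I_k}) : R :=
  \sum_(e in edges | P e.1 != P e.2) weight e.1 e.2.

(* For 0 < k the sets of costs below are nonempty, and they are bounded below
   by 0, so their infima are genuine. *)
Definition integral_opt : R :=
  inf [set cut_cost P | P in [set P | is_multiway_partition P]].

Definition simplex : set 'rV[R]_k :=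
  [set x | (forall i, 0 <= x 0 i <= 1) /\ \sum_i x 0 i = 1].

Definition l1_norm (x : 'rV[R]_k) : R := \sum_i `|x 0 i|.

Definition ckr_feasible (x : V -> 'rV[R]_k) : Prop :=
  (forall u, simplex (x u)) /\
  (forall i, x (terminal I i) = delta_mx 0 i).

Definition ckr_cost (x : V -> 'rV[R]_k) : R :=
  \sum_(e in edges) weight e.1 e.2 * (2^-1 * l1_norm (x e.1 - x e.2)).

Definition ckr_opt : R :=
  inf [set ckr_cost x | x in [set x | ckr_feasible x]].

(* Meaningful only when 0 < ckr_opt, as division by 0 yields 0. *)
Definition integrality_gap : R := integral_opt / ckr_opt.

End MultiwayCut.

(* Main.v *)
(** Every 2-face of the simplex carries a triangular grid of side [n = 3m + 2]
    whose edges have unit weight, except that in the three corners of size about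
    [n / 3] the edges transverse to the corner are deleted and weight decreasing
    linearly from the corner is added along the two sides meeting there; every
    edge of a side of the simplex moreover gets a multiple of [m + 1].  Placing
    the grid points at themselves gives all edges CKR length [1 / n].

    To bound an integral cut from below, fix a face and call its own three labels
    One, Two, Three and all the others Other.  In each upward triangle, three
    times the number of cut edges is at least the sum of the potentials of the
    three vertices plus that of the transfers along the three edges.  The three
    potentials of a vertex add up to 0 and the transfers around a downward
    triangle add up to something nonnegative, so only the sides of the face
    remain.  Each side yields the full [6 (m + 1)], unless the label of the
    opposite corner occurs on it; the loss is then at most [6 (m + 1)], and is
    paid by the weight on the sides of the simplex, because a side on which [d]
    labels occur is cut at least [d - 1] times. *)
Require Import Defs.
From HB Require Import structures.
From mathcomp Require Import all_boot all_order all_algebra.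
From mathcomp Require Import classical_sets reals.
From mathcomp Require Import zify ring lra.

Set Implicit Arguments.
Unset Strict Implicit.
Unset Printing Implicit Defensive.

Import Order.TTheory GRing.Theory Num.Theory.

Local Open Scope ring_scope.

(** * Sums over triangular grids *)

Definition tri_sum (V : nmodType) (N : nat) (h : nat -> nat -> nat -> V) : V :=
  \sum_(a < N.+1) \sum_(b < (N - a).+1) h a b (N - a - b)%N.

Lemma tri_sum_ext (V : nmodType) N (h h' : nat -> nat -> nat -> V) :
  (forall a b c, (a + b + c = N)%N -> h a b c = h' a b c) ->
  tri_sum N h = tri_sum N h'.
Proof.
move=> hh; apply: eq_bigr => a _; apply: eq_bigr => b _; apply: hh.
by have := ltn_ord a; have := ltn_ord b; lia.
Qed.

Lemma tri_sumD (V : nmodType) N (h h' : nat -> nat -> nat -> V) :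
  tri_sum N (fun a b c => h a b c + h' a b c) = tri_sum N h + tri_sum N h'.
Proof.
by rewrite /tri_sum -big_split; apply: eq_bigr => a _; rewrite -big_split.
Qed.

(** Vertices, upward triangles and downward triangles of a face are indexed by grids of sizes
    [3 * m + 2], [3 * m + 1] and [3 * m]. The three peelings pass from one size to the next and
    leave one side over. *)
Lemma tri_sum_shift1 (V : nmodType) N (h : nat -> nat -> nat -> V) :
  tri_sum N.+1 h =
    \sum_(s < N.+2) h 0 s (N.+1 - s)%N + tri_sum N (fun a b c => h a.+1 b c).
Proof. by rewrite /tri_sum big_ord_recl /= !subn0. Qed.

Lemma tri_sum_shift2 (V : nmodType) N (h : nat -> nat -> nat -> V) :
  tri_sum N.+1 h =
    \sum_(s < N.+2) h s 0 (N.+1 - s)%N + tri_sum N (fun a b c => h a b.+1 c).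
Proof.
rewrite /tri_sum big_ord_recr /= subnn big_ord1 subnn.
rewrite (big_ord_recr N.+1) /= subnn addrAC; congr (_ + _).
rewrite -big_split; apply: eq_bigr => a _ /=.
have aN : (a <= N)%N by rewrite -ltnS ltn_ord.
by rewrite big_ord_recl /= subSn // subn0.
Qed.

Lemma tri_sum_shift3 (V : nmodType) N (h : nat -> nat -> nat -> V) :
  tri_sum N.+1 h =
    \sum_(s < N.+2) h s (N.+1 - s)%N 0 + tri_sum N (fun a b c => h a b c.+1).
Proof.
rewrite /tri_sum big_ord_recr /= subnn big_ord1 subnn.
rewrite (big_ord_recr N.+1) /= subnn addrAC; congr (_ + _).
rewrite -big_split; apply: eq_bigr => a _ /=.
have aN : (a <= N)%N by rewrite -ltnS ltn_ord.
rewrite subSn // big_ord_recr /= subnn addrC; congr (_ + _).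
by apply: eq_bigr => b _; rewrite subSn // -ltnS ltn_ord.
Qed.

Lemma tri_sum_rot (V : nmodType) N (h : nat -> nat -> nat -> V) :
  tri_sum N h = tri_sum N (fun a b c => h b c a).
Proof.
elim: N h => [|N IH] h; first by rewrite /tri_sum !big_ord1.
rewrite tri_sum_shift1 tri_sum_shift2 IH; congr (_ + _).
rewrite (reindex_inj rev_ord_inj); apply: eq_bigr => s _ /=.
by congr h; have := ltn_ord s; lia.
Qed.

Lemma ler_tri_sum (V : numDomainType) N (h h' : nat -> nat -> nat -> V) :
  (forall a b c, (a + b + c = N)%N -> h a b c <= h' a b c) ->
  tri_sum N h <= tri_sum N h'.
Proof.
move=> hh; apply: ler_sum => a _; apply: ler_sum => b _; apply: hh.
by have := ltn_ord a; have := ltn_ord b; lia.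
Qed.

(** * The cost of a labelled face *)

Variant label := One | Two | Three | Other.

Definition label_eqb (p q : label) : bool :=
  match p, q with
  | One, One | Two, Two | Three, Three | Other, Other => true
  | _, _ => false
  end.

Lemma label_eqP : Equality.axiom label_eqb.
Proof. by case; case; constructor. Qed.

HB.instance Definition _ := hasDecEq.Build label label_eqP.

Definition cut (T : eqType) (p q : T) : int := (p != q)%:R.

(* Potentials and transfers are measured in thirds of an edge.  Other behaves
   like an even mixture of two of the three labels; [e] tells that [i] is the one
   left out, which depends on the position of the vertex in the face. *)
Definition potential (i : label) (e : bool) (p : label) : int :=
  if p == i then 4 else if p == Other then (if e then -2 else 1) else -2.

(* For an edge parallel to the side opposite to corner [l] whose end nearer to
   corner [i] is labelled [p], this is the share of its cost, possibly negative,
   that the adjacent upward triangle cedes to the adjacent downward one.  Without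
   transfers, labels One, Two, Three would require [12 <= 9] of an upward
   triangle. *)
Definition transfer (i l p q : label) : int :=
  if p == q then 0 else if (p == i) && (q != l) then -1 else 1.

(* Near corner [i] only the distinction between [i] and the rest matters. *)
Definition collapse (b : bool) (i p : label) : label :=
  if b && (p != i) then Other else p.

Lemma up_triangle_bound (e1 e2 e3 : bool) (p q r : label) :
  (e1 + e2 + e3 = 1)%N ->
  potential One e1 p + potential Two e2 q + potential Three e3 r +
    (transfer One Three p q + transfer Two One q r + transfer Three Two r p)
  <= 3 * (cut p q + cut q r + cut r p).
Proof. by case: e1; case: e2; case: e3 => //; case: p; case: q; case: r. Qed.

Lemma down_triangle_bound (p q r : label) :
  0 <= transfer One Three q p + transfer Two One r q + transfer Three Two p r.
Proof. by case: p; case: q; case: r. Qed.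

(** * Cuts along paths and sides *)

Lemma cut_ge0 (T : eqType) (p q : T) : 0 <= cut p q.
Proof. exact: ler0n. Qed.

Lemma cutC (T : eqType) (p q : T) : cut p q = cut q p.
Proof. by rewrite /cut eq_sym. Qed.

Lemma cut_triangle (T : eqType) (p q r : T) : cut p r <= cut p q + cut q r.
Proof. by rewrite /cut; do 3 case: eqP => //=; congruence. Qed.

Lemma cut_path (T : eqType) (h : nat -> T) N :
  cut (h N) (h 0) <= \sum_(s < N) cut (h s) (h s.+1).
Proof.
elim: N => [|N IH]; first by rewrite big_ord0 /cut eqxx.
rewrite big_ord_recr /= addrC (cutC (h N)).
exact: le_trans (cut_triangle _ (h N) _) (lerD (lexx _) IH).
Qed.

Lemma sum_interval (N a b : nat) :
  (\sum_(s < N) (a <= s < b) = minn b N - a)%N.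
Proof.
elim: N => [|N IH]; first by rewrite big_ord0 minn0.
by rewrite big_ord_recr /= IH; lia.
Qed.

Ltac decide_leq :=
  repeat match goal with
  | |- context [(?x <= ?y)%N] =>
      first [ have -> : (x <= y)%N by lia | have -> : (x <= y)%N = false by lia ]
  end.

(** A point labelled differently from the corner is separated from it by a cut edge. The edge from
    [s] to [s.+1] is charged by the [m - s] points beyond it, which explains the linearly decreasing
    weight on the sides. *)
Lemma corner_count (T : eqType) (h : nat -> T) m :
  \sum_(s < m.+1) cut (h s) (h 0) <=
  \sum_(s < m) (m - s)%:R * cut (h s) (h s.+1).
Proof.
elim: m => [|m IH]; first by rewrite big_ord1 big_ord0 /cut eqxx.
rewrite big_ord_recr /=.
apply: le_trans (lerD IH (cut_path h m.+1)) _.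
rewrite !(big_ord_recr m) /= addrA subSn // subnn mul1r lerD2r.
rewrite -big_split ler_sum //= => s _.
by rewrite subSn ?(ltnW (ltn_ord s)) // -natr1 mulrDl mul1r.
Qed.

Lemma corner_count_widen (T : eqType) (h : nat -> T) m N : (m <= N)%N ->
  \sum_(s < N.+1) (s <= m)%:R * cut (h s) (h 0) <=
  \sum_(s < N) (m - s)%:R * cut (h s) (h s.+1).
Proof.
move=> mN.
have -> : \sum_(s < N.+1) (s <= m)%:R * cut (h s) (h 0) =
    \sum_(s < m.+1) cut (h s) (h 0).
  rewrite (big_ord_widen N.+1 (fun s => cut (h s) (h 0))) // [RHS]big_mkcond.
  by apply: eq_bigr => s _; rewrite ltnS; case: leq; rewrite (mul1r, mul0r).
apply: le_trans (corner_count h m) _.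
rewrite (big_ord_widen N (fun s => (m - s)%:R * cut (h s) (h s.+1))) //.
rewrite big_mkcond ler_sum // => s _.
by case: ifP => // _; rewrite mulr_ge0 ?cut_ge0 ?ler0n.
Qed.

Lemma corner_count_rev (T : eqType) (h : nat -> T) m N : (m <= N)%N ->
  \sum_(s < N.+1) (N - s <= m)%:R * cut (h s) (h N) <=
  \sum_(s < N) (m - (N.-1 - s))%:R * cut (h s.+1) (h s).
Proof.
move=> mN; have := @corner_count_widen _ (fun s => h (N - s)%N) m N mN.
rewrite subn0 (reindex_inj rev_ord_inj) => /le_trans/=.
have -> : \sum_(i < N.+1) (N.+1 - i.+1 <= m)%:R * cut (h (N - (N.+1 - i.+1))%N) (h N)
   = \sum_(s < N.+1) (N - s <= m)%:R * cut (h s) (h N).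
  by apply: eq_bigr => s _; rewrite subSS subKn // -ltnS ltn_ord.
apply; rewrite (reindex_inj rev_ord_inj); apply: ler_sum => s _ /=.
have sN := ltn_ord s.
have -> : (N - (N - s.+1) = s.+1)%N by lia.
have -> : (N - (N - s.+1).+1 = s)%N by lia.
by have -> : (N.-1 - s = N - s.+1)%N by lia.
Qed.

(** Corner [j] sits at [s = 0] and corner [i] at [s = 3 * m + 2]. Every point is worth 2, less 3 in
    a corner region if its label is not that of the corner, and less 6 in the middle if the opposite
    label [l] is allowed on the side. *)
Lemma side_term_bound (m s : nat) (i j l p : label) (o : bool) :
  i != j -> i != l -> j != l -> Other \notin [:: i; j; l] ->
  (s <= 3 * m + 2)%N -> ((p == l) ==> o) ->
  2 - 3 * ((3 * m + 2 - s <= m)%:R * cut p i) - 3 * ((s <= m)%:R * cut p j)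
    - 6 * ((m < s <= 2 * m + 1)%N && o)%:R <=
  - potential l ((m < s)%N == (m < 3 * m + 2 - s)%N)
     (collapse (2 * m + 1 < s)%N i (collapse (2 * m + 1 < 3 * m + 2 - s)%N j p)).
Proof.
move=> ij il jl Ol sn po.
have [sm|sm] := leqP s m; last have [ms|ms] := leqP s (2 * m + 1).
all: decide_leq.
all: by move: ij il jl Ol po; case: i; case: j; case: l; case: p; case: o.
Qed.

(** The [3 * m + 3] points are worth 2 each. The decreasing side weights cover the losses near the
    corners, by [corner_count]; what remains is a loss of 6 at each of the [m.+1] middle points. *)
Lemma side_bound (m : nat) (f : nat -> label) (i j l : label) (o : bool) :
  i != j -> i != l -> j != l -> Other \notin [:: i; j; l] ->
  f (3 * m + 2)%N = i -> f 0 = j ->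
  (forall s, (s <= 3 * m + 2)%N -> f s = l -> o) ->
  (6 * m.+1)%:R - (6 * m.+1 * o)%:R <=
  - (\sum_(s < (3 * m + 2).+1)
      potential l ((m < s)%N == (m < 3 * m + 2 - s)%N)
       (collapse (2 * m + 1 < s)%N i
          (collapse (2 * m + 1 < 3 * m + 2 - s)%N j (f s)))) +
  3 * \sum_(s < 3 * m + 2)
      ((m - s)%N + (m - (3 * m + 1 - s))%N)%:R * cut (f s.+1) (f s).
Proof.
move=> ij il jl Ol fi fj fl.
have mn : (m <= 3 * m + 2)%N by lia.
have ci := @corner_count_rev _ f _ _ mn.
have cj := @corner_count_widen _ f _ _ mn.
have po (s : 'I_(3 * m + 2).+1) : (f s == l) ==> o.
  by apply/implyP => /eqP/fl; apply; rewrite -ltnS ltn_ord.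
have sp := @ler_sum _ _ (index_enum 'I_(3 * m + 2).+1) xpredT _ _
   (fun s _ => side_term_bound ij il jl Ol (ltn_ord s : s <= _)%N (po s)).
rewrite sumrN in sp.
rewrite [X in 3 * X](_ : _ =
   \sum_(s < 3 * m + 2) (m - s)%:R * cut (f s) (f s.+1) +
   \sum_(s < 3 * m + 2) (m - ((3 * m + 2).-1 - s))%:R * cut (f s.+1) (f s));
  last first.
  rewrite -big_split; apply: eq_bigr => s _ /=.
  have -> : ((3 * m + 2).-1 = 3 * m + 1)%N by lia.
  by rewrite natrD mulrDl (cutC (f s)).
rewrite fi in ci; rewrite fj in cj.
have om : \sum_(s < (3 * m + 2).+1) ((m < s <= 2 * m + 1)%N && o)%:R
    = (m.+1 * o)%:R :> int.
  case: {fl po sp} o; last first.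
    by rewrite muln0 big1 // => s _; rewrite andbF.
  rewrite muln1 -natr_sum; congr _%:R.
  under eq_bigr do rewrite andbT.
  rewrite (eq_bigr (fun s : 'I__ => (m.+1 <= s < 2 * m + 2)%N : nat)) => [|s _].
    by rewrite sum_interval; lia.
  by congr nat_of_bool; lia.
move: sp; rewrite !big_split /= !sumrN -!mulr_sumr om.
rewrite sumr_const card_ord => sp.
have -> : (6 * m.+1)%:R = (3 * m + 2).+1%:R + (3 * m + 2).+1%:R :> int.
  by rewrite -natrD; congr _%:R; lia.
have -> : (6 * m.+1 * o)%:R = 6 * (m.+1 * o)%:R :> int by rewrite -natrM mulnA.
lra.
Qed.

(* In the next definitions [(a, b, c)] with [a + b + c = 3m + 1] stands for the
   upward triangle with vertices [(a+1, b, c)], [(a, b+1, c)], [(a, b, c+1)], and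
   [edge_weight m a b c] is the weight of the edge between the first two.  The
   triangles next to a corner region have their weight doubled: some downward
   triangles there have lost an edge and the transfers along the two others may
   be negative.  This, like the summand 1 of [side_weight], is negligible. *)
Definition on_interface (m a b c : nat) : bool :=
  [|| a == 2 * m + 1, b == 2 * m + 1 | c == 2 * m + 1]%N.

Lemma on_interface_rot m a b c : on_interface m b c a = on_interface m a b c.
Proof. by rewrite /on_interface [RHS]orbC orbA. Qed.

Definition base_weight (m a b c : nat) : nat :=
  ((c <= 2 * m + 1) + on_interface m a b c)%N.

Definition side_weight (m a b : nat) : nat := (1 + ((m - a) + (m - b)))%N.

Definition edge_weight (m a b c : nat) : nat :=
  (base_weight m a b c + (c == 0) * side_weight m a b)%N.

(** Where [e] holds, Other has the same potential as the labels different from [i]. This makes the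
    corner regions fit the central triangles that touch them. *)
Lemma potential_collapse (i : label) (e b : bool) (p : label) :
  i != Other -> b ==> e -> potential i e (collapse b i p) = potential i e p.
Proof. by case: i; case: p; case: e; case: b. Qed.

Lemma tri_sumZ (N : nat) (x : int) (h : nat -> nat -> nat -> int) :
  tri_sum N (fun a b c => x * h a b c) = x * tri_sum N h.
Proof.
by rewrite /tri_sum mulr_sumr; apply: eq_bigr => a _; rewrite mulr_sumr.
Qed.

Lemma tri_slice1 (N : nat) (h : nat -> nat -> nat -> int) :
  tri_sum N.+1 (fun a b c => (a == 0)%:R * h a b c) =
  \sum_(s < N.+2) h 0 s (N.+1 - s)%N.
Proof.
rewrite tri_sum_shift1 [X in _ + X]big1 => [|a _]; last first.
  by rewrite big1 // => b _; rewrite mul0r.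
by rewrite addr0; apply: eq_bigr => s _; rewrite mul1r.
Qed.

Lemma tri_slice2 (N : nat) (h : nat -> nat -> nat -> int) :
  tri_sum N.+1 (fun a b c => (b == 0)%:R * h a b c) =
  \sum_(s < N.+2) h s 0 (N.+1 - s)%N.
Proof.
rewrite tri_sum_shift2 [X in _ + X]big1 => [|a _]; last first.
  by rewrite big1 // => b _; rewrite mul0r.
by rewrite addr0; apply: eq_bigr => s _; rewrite mul1r.
Qed.

Lemma tri_slice3 (N : nat) (h : nat -> nat -> nat -> int) :
  tri_sum N.+1 (fun a b c => (c == 0)%:R * h a b c) =
  \sum_(s < N.+2) h s (N.+1 - s)%N 0.
Proof.
rewrite tri_sum_shift3 [X in _ + X]big1 => [|a _]; last first.
  by rewrite big1 // => b _; rewrite mul0r.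
by rewrite addr0; apply: eq_bigr => s _; rewrite mul1r.
Qed.

Lemma side_weightE (m N : nat) (h : nat -> int) :
  \sum_(s < N.+1) (side_weight m s (N - s))%:R * h s =
  \sum_(s < N.+1) h s +
  \sum_(s < N.+1) ((m - s)%N + (m - (N - s))%N)%:R * h s.
Proof.
rewrite -big_split; apply: eq_bigr => s _ /=.
by rewrite /side_weight natrD mulrDl mul1r.
Qed.

Lemma side_weightC (m a b : nat) : side_weight m a b = side_weight m b a.
Proof. by rewrite /side_weight addnCA addnA addnC addnA addnC addnA. Qed.

(** * Lower bound on the cut of one face *)

Section Face.
Variables (m : nat) (F : nat -> nat -> nat -> label).

Let cut12 a b c := cut (F a.+1 b c) (F a b.+1 c).
Let cut23 a b c := cut (F a b.+1 c) (F a b c.+1).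
Let cut31 a b c := cut (F a b c.+1) (F a.+1 b c).

(** At most one collapse acts, since two coordinates above [2 * m + 1] would exceed the sum
    [3 * m + 2]. *)
Let corner_label x y z :=
  collapse (2 * m + 1 < x)%N One
    (collapse (2 * m + 1 < y)%N Two (collapse (2 * m + 1 < z)%N Three (F x y z))).

Let pot1 x y z := potential One ((m < y)%N == (m < z)%N) (corner_label x y z).
Let pot2 x y z := potential Two ((m < x)%N == (m < z)%N) (corner_label x y z).
Let pot3 x y z := potential Three ((m < x)%N == (m < y)%N) (corner_label x y z).

Let central a b c := [&& a <= 2 * m + 1, b <= 2 * m + 1 & c <= 2 * m + 1]%N.

(** Only central triangles take part in transfers; on the interface an extra copy of the cut makes
    the flow nonnegative. *)
Let flow12 a b c :=
  (central a b c)%:R * (transfer One Three (F a.+1 b c) (F a b.+1 c) +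
                        (on_interface m a b c)%:R * cut12 a b c).
Let flow23 a b c :=
  (central a b c)%:R * (transfer Two One (F a b.+1 c) (F a b c.+1) +
                        (on_interface m a b c)%:R * cut23 a b c).
Let flow31 a b c :=
  (central a b c)%:R * (transfer Three Two (F a b c.+1) (F a.+1 b c) +
                        (on_interface m a b c)%:R * cut31 a b c).

(** One or two coordinates exceed [m], so exactly one of the three flags is true. Other then gives
    [-2 + 1 + 1], any other label [4 - 2 - 2]. *)
Lemma pot_sum x y z : (x + y + z = 3 * m + 2)%N ->
  pot1 x y z + pot2 x y z + pot3 x y z = 0.
Proof.
move=> xyz; rewrite /pot1 /pot2 /pot3.
have [mx|mx] := leqP x m; have [my|my] := leqP y m; have [mz|mz] := leqP z m;
  try lia; by case: (corner_label x y z).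
Qed.

Lemma up_bound a b c : (a + b + c = 3 * m + 1)%N ->
  pot1 a.+1 b c + pot2 a b.+1 c + pot3 a b c.+1 +
    (flow12 a b c + flow23 a b c + flow31 a b c) <=
  3 * ((base_weight m a b c)%:R * cut12 a b c +
       (base_weight m b c a)%:R * cut23 a b c +
       (base_weight m c a b)%:R * cut31 a b c).
Proof.
move=> abc.
rewrite /pot1 /pot2 /pot3 /flow12 /flow23 /flow31 /cut12 /cut23 /cut31 /corner_label.
have [/and3P[ha hb hc]|] := boolP (central a b c).
  have -> : (2 * m + 1 < b)%N = false by lia.
  have -> : (2 * m + 1 < a)%N = false by lia.
  have -> : (2 * m + 1 < c)%N = false by lia.
  (* Only the incremented coordinate can exceed [2 * m + 1]; the other two are then at most [m], so
     the flag is true. *)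
  rewrite /= !potential_collapse //; try by apply/implyP => ?; apply/eqP; lia.
  (* The flag of a vertex ignores its incremented coordinate, so it depends on the triangle only; as
     [a + b + c = 3 * m + 1], again one or two of [a], [b], [c] exceed [m]. *)
  have e123 : (((m < b) == (m < c)) + ((m < a) == (m < c)) +
               ((m < a) == (m < b)) = 1)%N.
    by case: (leqP a m); case: (leqP b m); case: (leqP c m) => //; lia.
  have := up_triangle_bound (F a.+1 b c) (F a b.+1 c) (F a b c.+1) e123.
  have {e123} := cut_ge0 (F a.+1 b c) (F a b.+1 c).
  have := cut_ge0 (F a b.+1 c) (F a b c.+1).
  have := cut_ge0 (F a b c.+1) (F a.+1 b c).
  rewrite /base_weight ha hb hc (on_interface_rot m b c a)
    (on_interface_rot m a b c).
  by case: on_interface => /=; lra.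
(* In a corner region there are no transfers and the transverse edge has base weight 0; a case check
   on the collapsed labels suffices. *)
move=> nc; have itf : on_interface m a b c = false.
  by move: nc; rewrite /central /on_interface; lia.
rewrite !mul0r !addr0 /base_weight (on_interface_rot m b c a)
  (on_interface_rot m a b c) itf.
move: nc; rewrite !negb_and -!ltnNge => /or3P[] h; decide_leq;
  by case: (F a.+1 b c); case: (F a b.+1 c); case: (F a b c.+1).
Qed.

Lemma down_bound a b c : (a + b + c = 3 * m)%N ->
  0 <= flow12 a b c.+1 + flow23 a.+1 b c + flow31 a b.+1 c.
Proof.
move=> abc; rewrite /flow12 /flow23 /flow31 /cut12 /cut23 /cut31.
set p := F a b.+1 c.+1; set q := F a.+1 b c.+1; set r := F a.+1 b.+1 c.
have [/and3P[h1 h2 h3]|nh] :=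
  boolP [&& central a b c.+1, central a.+1 b c & central a b.+1 c].
  have := down_triangle_bound p q r; rewrite h1 h2 h3.
  have := cut_ge0 q p; have := cut_ge0 r q; have := cut_ge0 p r.
  by do 3 case: on_interface => /=; lra.
(* If some neighbour lies in a corner region, the central ones lie on the interface, where each flow
   is nonnegative by itself. *)
have i1 : central a b c.+1 -> on_interface m a b c.+1.
  by move: nh; rewrite /central /on_interface; lia.
have i2 : central a.+1 b c -> on_interface m a.+1 b c.
  by move: nh; rewrite /central /on_interface; lia.
have i3 : central a b.+1 c -> on_interface m a b.+1 c.
  by move: nh; rewrite /central /on_interface; lia.
apply: addr_ge0; first apply: addr_ge0; clearbody p q r.
- case: central i1 => [->//|_]; last by rewrite mul0r.
  by case: p; case: q.
- case: central i2 => [->//|_]; last by rewrite mul0r.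
  by case: q; case: r.
- case: central i3 => [->//|_]; last by rewrite mul0r.
  by case: p; case: r.
Qed.

(** No downward triangle lies beyond a side of the face, so the flow there may be negative; the
    constant summand of [side_weight] makes up for it. *)
Lemma flow12_cut a b c : - cut12 a b c <= flow12 a b c.
Proof.
rewrite /flow12 /cut12 /transfer; case: central; case: on_interface;
by case: F; case: F.
Qed.

Lemma flow23_cut a b c : - cut23 a b c <= flow23 a b c.
Proof.
rewrite /flow23 /cut23 /transfer; case: central; case: on_interface;
by case: F; case: F.
Qed.

Lemma flow31_cut a b c : - cut31 a b c <= flow31 a b c.
Proof.
rewrite /flow31 /cut31 /transfer; case: central; case: on_interface;
by case: F; case: F.
Qed.

(** Summing [up_bound] counts every vertex with its three potentials, which cancel, except that
    [pot1] misses the side opposite to corner One, and likewise for [pot2] and [pot3]. The flows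
    regroup around downward triangles. Only the sides are left, and [side_bound] treats them. *)
Lemma face_bound (o1 o2 o3 : bool) :
  F (3 * m + 2)%N 0 0 = One -> F 0 (3 * m + 2)%N 0 = Two ->
  F 0 0 (3 * m + 2)%N = Three ->
  (forall s, (s <= 3 * m + 2)%N -> F 0 s (3 * m + 2 - s)%N = One -> o1) ->
  (forall s, (s <= 3 * m + 2)%N -> F s 0 (3 * m + 2 - s)%N = Two -> o2) ->
  (forall s, (s <= 3 * m + 2)%N -> F s (3 * m + 2 - s)%N 0 = Three -> o3) ->
  (6 * m.+1)%:R - (2 * m.+1 * (o1 + o2 + o3))%:R <=
  tri_sum (3 * m + 1) (fun a b c =>
    (edge_weight m a b c)%:R * cut12 a b c +
    (edge_weight m b c a)%:R * cut23 a b c +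
    (edge_weight m c a b)%:R * cut31 a b c).
Proof.
have n2 : (3 * m + 2 = (3 * m).+2)%N by rewrite addn2.
have n1 : (3 * m + 1 = (3 * m).+1)%N by rewrite addn1.
rewrite n2 n1 => F1 F2 F3 H1 H2 H3.
have s1 := @side_bound m (fun s => F 0 s ((3 * m).+2 - s)%N) Two Three One o1.
have s2 := @side_bound m (fun s => F s 0 ((3 * m).+2 - s)%N) One Three Two o2.
have s3 := @side_bound m (fun s => F s ((3 * m).+2 - s)%N 0) One Two Three o3.
rewrite n2 n1 subnn subn0 in s1 s2 s3.
move: {s1 H1}(s1 isT isT isT isT F2 F3 H1) {s2 H2}(s2 isT isT isT isT F1 F3 H2)
  {s3 H3}(s3 isT isT isT isT F1 F2 H3).
have up := ler_tri_sum up_bound.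
have down : 0 <= tri_sum (3 * m) (fun a b c =>
    flow12 a b c.+1 + flow23 a.+1 b c + flow31 a b.+1 c).
  apply: sumr_ge0 => a _; apply: sumr_ge0 => b _; apply: down_bound.
  by have := ltn_ord a; have := ltn_ord b; lia.
have pot0 : tri_sum (3 * m).+2 pot1 + tri_sum (3 * m).+2 pot2 +
    tri_sum (3 * m).+2 pot3 = 0.
  rewrite -!tri_sumD -[RHS](_ : tri_sum (3 * m).+2 (fun _ _ _ => 0) = 0).
    by apply: tri_sum_ext => a b c abc; apply: pot_sum; rewrite n2.
  by rewrite /tri_sum big1 // => a _; rewrite big1.
move: up down pot0; rewrite n1; move: (3 * m)%N => K.
rewrite tri_sumZ !tri_sumD.
rewrite (tri_sum_shift1 K.+1 pot1) (tri_sum_shift2 K.+1 pot2) (tri_sum_shift3 K.+1 pot3).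
rewrite (tri_sum_shift3 K flow12) (tri_sum_shift1 K flow23) (tri_sum_shift2 K flow31).
have -> : tri_sum K.+1 (fun a b c => (edge_weight m a b c)%:R * cut12 a b c) =
    tri_sum K.+1 (fun a b c => (base_weight m a b c)%:R * cut12 a b c) +
    (\sum_(s < K.+2) cut12 s (K.+1 - s)%N 0 +
     \sum_(s < K.+2) ((m - s)%N + (m - (K.+1 - s))%N)%:R *
       cut12 s (K.+1 - s)%N 0).
  rewrite -(side_weightE m K.+1 (fun s => cut12 s (K.+1 - s)%N 0))
    -(tri_slice3 K (fun a b c =>
    (side_weight m a b)%:R * cut12 a b c)) -tri_sumD; apply: tri_sum_ext => a b c _.
  by rewrite natrD natrM mulrDl mulrA.
have -> : tri_sum K.+1 (fun a b c => (edge_weight m b c a)%:R * cut23 a b c) =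
    tri_sum K.+1 (fun a b c => (base_weight m b c a)%:R * cut23 a b c) +
    (\sum_(s < K.+2) cut23 0 s (K.+1 - s)%N +
     \sum_(s < K.+2) ((m - s)%N + (m - (K.+1 - s))%N)%:R *
       cut23 0 s (K.+1 - s)%N).
  rewrite -(side_weightE m K.+1 (fun s => cut23 0 s (K.+1 - s)%N))
    -(tri_slice1 K (fun a b c =>
    (side_weight m b c)%:R * cut23 a b c)) -tri_sumD; apply: tri_sum_ext => a b c _.
  by rewrite natrD natrM mulrDl mulrA.
have -> : tri_sum K.+1 (fun a b c => (edge_weight m c a b)%:R * cut31 a b c) =
    tri_sum K.+1 (fun a b c => (base_weight m c a b)%:R * cut31 a b c) +
    (\sum_(s < K.+2) cut31 s 0 (K.+1 - s)%N +
     \sum_(s < K.+2) ((m - s)%N + (m - (K.+1 - s))%N)%:R *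
       cut31 s 0 (K.+1 - s)%N).
  rewrite -(side_weightE m K.+1 (fun s => cut31 s 0 (K.+1 - s)%N))
    -(tri_slice2 K (fun a b c =>
    (side_weight m a c)%:R * cut31 a b c)) -tri_sumD; apply: tri_sum_ext => a b c _.
  by rewrite natrD natrM mulrDl mulrA (side_weightC m c a).
have f1 : - (\sum_(s < K.+2) cut12 s (K.+1 - s)%N 0) <=
    \sum_(s < K.+2) flow12 s (K.+1 - s)%N 0.
  by rewrite -sumrN; apply: ler_sum => s _; apply: flow12_cut.
have f2 : - (\sum_(s < K.+2) cut23 0 s (K.+1 - s)%N) <=
    \sum_(s < K.+2) flow23 0 s (K.+1 - s)%N.
  by rewrite -sumrN; apply: ler_sum => s _; apply: flow23_cut.
have f3 : - (\sum_(s < K.+2) cut31 s 0 (K.+1 - s)%N) <=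
    \sum_(s < K.+2) flow31 s 0 (K.+1 - s)%N.
  by rewrite -sumrN; apply: ler_sum => s _; apply: flow31_cut.
have c1 : 0 <= \sum_(s < K.+2) cut12 s (K.+1 - s)%N 0.
  by apply: sumr_ge0 => s _; apply: cut_ge0.
have c2 : 0 <= \sum_(s < K.+2) cut23 0 s (K.+1 - s)%N.
  by apply: sumr_ge0 => s _; apply: cut_ge0.
have c3 : 0 <= \sum_(s < K.+2) cut31 s 0 (K.+1 - s)%N.
  by apply: sumr_ge0 => s _; apply: cut_ge0.
have -> : \sum_(s < K.+2) (m - s + (m - (K.+1 - s)))%:R *
     cut (F 0 s.+1 (K.+2 - s.+1)%N) (F 0 s (K.+2 - s)%N) =
   \sum_(s < K.+2) (m - s + (m - (K.+1 - s)))%:R * cut23 0 s (K.+1 - s)%N.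
  by apply: eq_bigr => s _; rewrite subSS (@subSn s K.+1) // -ltnS ltn_ord.
have -> : \sum_(s < K.+2) (m - s + (m - (K.+1 - s)))%:R *
     cut (F s.+1 0 (K.+2 - s.+1)%N) (F s 0 (K.+2 - s)%N) =
   \sum_(s < K.+2) (m - s + (m - (K.+1 - s)))%:R * cut31 s 0 (K.+1 - s)%N.
  apply: eq_bigr => s _; rewrite subSS (@subSn s K.+1) ?[cut (F s.+1 _ _) _]cutC //.
  by rewrite -ltnS ltn_ord.
have -> : \sum_(s < K.+2) (m - s + (m - (K.+1 - s)))%:R *
     cut (F s.+1 (K.+2 - s.+1)%N 0) (F s (K.+2 - s)%N 0) =
   \sum_(s < K.+2) (m - s + (m - (K.+1 - s)))%:R * cut12 s (K.+1 - s)%N 0.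
  by apply: eq_bigr => s _; rewrite subSS (@subSn s K.+1) // -ltnS ltn_ord.
move=> up down pot0.
rewrite -[X in _ <= - X + _ -> _]/(\sum_(s < K.+3) pot1 0 s (K.+2 - s)%N) => s1.
rewrite -[X in _ <= - X + _ -> _]/(\sum_(s < K.+3) pot2 s 0 (K.+2 - s)%N) => s2.
rewrite -[X in _ <= - X + _ -> _]/(\sum_(s < K.+3) pot3 s (K.+2 - s)%N 0) => s3.
have e : 3 * (2 * m.+1 * (o1 + o2 + o3))%:R =
    (6 * m.+1 * o1)%:R + (6 * m.+1 * o2)%:R + (6 * m.+1 * o3)%:R :> int.
  by rewrite -!natrD -natrM; congr _%:R; lia.
clear -up down pot0 s1 s2 s3 e f1 f2 f3 c1 c2 c3.
lra.
Qed.

End Face.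

(** * Total weight of one face *)

Lemma sum_down (N p q : nat) : (p <= q)%N ->
  (2 * (\sum_(a < N) (a < p) * (q - a)) + minn N p * minn N p =
   minn N p * (2 * q + 1))%N.
Proof.
move=> pq; elim: N => [|N IH]; first by rewrite big_ord0 min0n.
rewrite big_ord_recr /=; move: IH; move: (\sum_(a < N) _)%N => S.
have [Np|pN] := boolP (N < p)%N; last first.
  have -> : minn N.+1 p = minn N p by lia.
  by rewrite /= mul0n addn0.
have -> : minn N p = N by lia.
have -> : minn N.+1 p = N.+1 by lia.
have [d ->] : exists d, q = (N + d)%N by exists (q - N)%N; lia.
by rewrite addKn /= mul1n; nia.
Qed.

Lemma sum_single (N p : nat) (f : nat -> nat) : (p < N)%N ->
  (\sum_(a < N) (a == p :> nat) * f a = f p)%N.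
Proof.
move=> pN; rewrite (bigD1 (Ordinal pN)) //= eqxx mul1n big1 ?addn0 // => a.
by rewrite -val_eqE /= => /negPf->.
Qed.

Lemma tri_sum_fst (N : nat) (f : nat -> nat) :
  tri_sum N (fun a _ _ => (f a)%:R : int) =
  (\sum_(a < N.+1) f a * (N.+1 - a))%:R.
Proof.
rewrite natr_sum; apply: eq_bigr => a _.
by rewrite sumr_const card_ord natrM mulr_natr subSn // -ltnS ltn_ord.
Qed.

(** Of the leading coefficient 5, the surviving grid edges of one direction account for 4 and the
    decreasing side weights for 1. With edges of length about [1 / (3 * m)], the three directions
    cost about [5 * m] per face, against the [6 * m.+1] of [face_bound]. *)
Lemma edge_weight_sum (m : nat) :
  tri_sum (3 * m + 1) (fun a b c => (edge_weight m a b c)%:R : int) <=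
  (5 * m.+1 ^ 2 + 4 * m.+1)%:R.
Proof.
have n1 : (3 * m + 1 = (3 * m).+1)%N by rewrite addn1.
pose f a : nat := (a < 2 * m + 2)%N.
pose g a : nat := (a == 2 * m + 1)%N.
have sf : tri_sum (3 * m + 1) (fun a _ _ => (f a)%:R : int) =
    (m.+1 * (4 * m + 3))%:R.
  rewrite tri_sum_fst; congr _%:R.
  have := @sum_down (3 * m + 1).+1 (2 * m + 2) (3 * m + 1).+1.
  have -> : minn (3 * m + 1).+1 (2 * m + 2) = (2 * m + 2)%N by lia.
  by rewrite /f => /(_ ltac:(lia)); nia.
have sg : tri_sum (3 * m + 1) (fun a _ _ => (g a)%:R : int) = (m.+1)%:R.
  by rewrite tri_sum_fst sum_single; [congr _%:R|]; lia.
have sh : \sum_(s < (3 * m).+2) (side_weight m s ((3 * m).+1 - s))%:R =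
    ((3 * m).+2 + m * m.+1)%:R :> int.
  rewrite -natr_sum; congr _%:R; rewrite !big_split /= sum_nat_const card_ord muln1.
  have e : (\sum_(s < (3 * m).+2) (m - s) * 2 = m * m.+1)%N.
    rewrite -big_distrl /=.
    have := @sum_down (3 * m).+2 m m (leqnn _).
    have -> : minn (3 * m).+2 m = m by lia.
    have -> : (\sum_(s < (3 * m).+2) (s < m) * (m - s) =
        \sum_(s < (3 * m).+2) (m - s))%N.
      by apply: eq_bigr => s _; case: ltnP; lia.
    by move: (\sum_(s < _) _)%N => S; lia.
  rewrite -e -big_distrl /= muln2 -addnn; congr (_ + (_ + _))%N.
  rewrite (reindex_inj rev_ord_inj); apply: eq_bigr => s _ /=.
  by have := ltn_ord s; lia.
rewrite n1 in sf sg *.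
apply: (@le_trans _ _ (tri_sum (3 * m).+1 (fun a b c =>
   (f c)%:R + ((g a)%:R + (g b)%:R + (g c)%:R) +
   (c == 0)%:R * (side_weight m a b)%:R))).
  apply: ler_tri_sum => a b c _; rewrite -natrM -!natrD ler_nat.
  rewrite /edge_weight /base_weight /on_interface /f /g leq_add2r leq_add //.
    by rewrite addn2 ltnS addn1.
  by case: eqP; case: eqP; case: eqP.
rewrite !tri_sumD (tri_slice3 _ (fun a b _ => (side_weight m a b)%:R)) sh.
rewrite (tri_sum_rot _ (fun _ _ c => (f c)%:R)) sf.
rewrite (tri_sum_rot _ (fun _ b _ => (g b)%:R)).
rewrite !(tri_sum_rot _ (fun _ _ c => (g c)%:R)) !sg -!natrD ler_nat.
nia.
Qed.

(** * The instance *)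

Section GadgetInstance.
Variables (R : realType) (k : nat) (V G : finType).
Variables (c : G -> nat) (src dst : G -> V).
Variables (t : 'I_k -> V) (t_inj : injective t).

Let arc_weight (u v : V) : nat :=
  (\sum_(g | (src g == u) && (dst g == v)) c g)%N.

Let neq_sym : symmetric (fun u v : V => u != v).
Proof. by move=> u v; rewrite eq_sym. Qed.

Let neq_irrefl : irreflexive (fun u v : V => u != v).
Proof. by move=> u; rewrite eqxx. Qed.

Let pair_weight (u v : V) : R := (arc_weight u v + arc_weight v u)%:R.

Let pair_weightC u v : pair_weight u v = pair_weight v u.
Proof. by rewrite /pair_weight addnC. Qed.

Let pair_weight_ge0 u v : u != v -> 0 <= pair_weight u v.
Proof. by move=> _; apply: ler0n. Qed.

(** Arcs may be parallel, opposite or loops. All pairs of distinct vertices are made edges, with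
    weight 0 if no arc joins them, so that sums over edges become sums over arcs. *)
Definition gadget_instance : multiway_cut R k :=
  MultiwayCut neq_sym neq_irrefl pair_weightC pair_weight_ge0 t_inj.

Lemma gadget_sum (f : V -> V -> R) :
  (forall u v, f u v = f v u) -> (forall u, f u u = 0) ->
  \sum_(e in edges gadget_instance) weight e.1 e.2 * f e.1 e.2 =
  \sum_g (c g)%:R * f (src g) (dst g).
Proof.
move=> fC f0.
transitivity (\sum_(e : V * V) (arc_weight e.1 e.2)%:R * f e.1 e.2).
  pose lt (e : V * V) := (enum_rank e.1 < enum_rank e.2)%N.
  rewrite (eq_bigl lt) => [|[u v]]; last first.
    by rewrite inE /= andb_idl // => /= uv; apply: contraTneq uv => ->; rewrite ltnn.
  rewrite [RHS](bigID lt) /=.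
  rewrite (eq_bigr (fun e => (arc_weight e.1 e.2)%:R * f e.1 e.2 +
    (arc_weight e.2 e.1)%:R * f e.2 e.1)) => [|[u v] _]; last first.
    by rewrite /= /pair_weight natrD mulrDl (fC v u).
  rewrite big_split; congr (_ + _).
  rewrite (reindex_inj (can_inj (@swap_pairK V V))) /=.
  rewrite big_mkcond [RHS]big_mkcond; apply: eq_bigr => -[u v] _.
  rewrite /lt /=; case: ltngtP => // /ord_inj/enum_rank_inj->.
  by rewrite f0 mulr0.
rewrite (eq_bigr (fun e => \sum_(g | (src g == e.1) && (dst g == e.2))
   (c g)%:R * f (src g) (dst g))) => [|[u v] _].
  rewrite (exchange_big_dep xpredT) //=; apply: eq_bigr => g _.
  rewrite (big_pred1 (src g, dst g)) // => -[u v] /=.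
  by rewrite eq_sym [dst g == _]eq_sym.
rewrite natr_sum mulr_suml; apply: eq_bigr => g /=.
by case/andP => /eqP-> /eqP->.
Qed.

Lemma gadget_cut_cost (P : {ffun V -> 'I_k}) :
  cut_cost (I := gadget_instance) P =
  (\sum_g (c g)%:R * cut (P (src g)) (P (dst g)))%:~R.
Proof.
rewrite /cut_cost big_mkcondr /=.
rewrite (eq_bigr (fun e : V * V => weight (m := gadget_instance) e.1 e.2 *
  (cut (P e.1) (P e.2))%:~R)) => [|e _].
  rewrite (gadget_sum (f := fun u v => (cut (P u) (P v))%:~R)).
  - by rewrite rmorph_sum; apply: eq_bigr => g _; rewrite rmorphM /= natz.
  - by move=> u v; rewrite cutC.
  - by move=> u; rewrite /cut eqxx.
by rewrite /cut; case: eqP; rewrite (mulr0, mulr1).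
Qed.

Lemma l1_normN (v : 'rV[R]_k) : l1_norm (- v) = l1_norm v.
Proof. by apply: eq_bigr => i _; rewrite mxE normrN. Qed.

Lemma gadget_ckr_cost (x : V -> 'rV[R]_k) :
  ckr_cost (I := gadget_instance) x =
  \sum_g (c g)%:R * (2^-1 * l1_norm (x (src g) - x (dst g))).
Proof.
rewrite /ckr_cost (gadget_sum (f := fun u v => 2^-1 * l1_norm (x u - x v))) //.
  by move=> u v; rewrite -l1_normN opprB.
move=> u; rewrite subrr /l1_norm big1 ?mulr0 // => i _.
by rewrite mxE normr0.
Qed.

End GadgetInstance.

Definition distinct3 (T : eqType) (i j l : T) : bool :=
  [&& i != j, i != l & j != l].

Section Instance.
Variables (m k : nat).

Local Notation n := (3 * m + 2)%N.
Local Notation N := (3 * m + 1)%N.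

(* [grid] also contains points outside the simplex; they are isolated. *)
Definition grid : finType := {ffun 'I_k -> 'I_n.+1}.

Definition face_point (i j l : 'I_k) (a b c : nat) : grid :=
  [ffun x => inord (if x == i then a else if x == j then b
                    else if x == l then c else 0)].

(** The first matching index wins in [face_point], so repeated indices yield sides and corners as
    degenerate cases. *)
Definition side_vertex (i j : 'I_k) (s : nat) : grid :=
  face_point i j j s (n - s) 0.

Definition corner (i : 'I_k) : grid := face_point i i i n 0 0.

(* Since all ordered triples of labels are listed, one edge per upward triangle
   is enough. *)
Definition gadget : finType :=
  (('I_k * 'I_k * 'I_k * {a : 'I_N.+1 & 'I_(N - a).+1}) +
   ('I_k * 'I_k * 'I_n))%type.

Definition gadget_weight (g : gadget) : nat :=
  match g with
  | inl (i, j, l, existT a b) =>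
      distinct3 i j l * edge_weight m a b (N - a - b)
  | inr (i, j, s) => (i != j) * (2 * m.+1)
  end.

Definition gadget_src (g : gadget) : grid :=
  match g with
  | inl (i, j, l, existT a b) => face_point i j l a.+1 b (N - a - b)
  | inr (i, j, s) => side_vertex i j s.+1
  end.

Definition gadget_dst (g : gadget) : grid :=
  match g with
  | inl (i, j, l, existT a b) => face_point i j l a b.+1 (N - a - b)
  | inr (i, j, s) => side_vertex i j s
  end.

Lemma corner_inj : injective corner.
Proof.
move=> i j /ffunP/(_ i); rewrite !ffunE eqxx.
case: eqP => // _ /(congr1 val); rewrite /= !inordK //.
by rewrite addn2.
Qed.

Lemma gadget_sumE (A : pzRingType) (h : grid -> grid -> A) :
  \sum_g (gadget_weight g)%:R * h (gadget_src g) (gadget_dst g) =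
  \sum_i \sum_j \sum_l (distinct3 i j l)%:R *
    tri_sum N (fun a b c => (edge_weight m a b c)%:R *
      h (face_point i j l a.+1 b c) (face_point i j l a b.+1 c)) +
  \sum_i \sum_j (i != j)%:R *
    ((2 * m.+1)%:R *
      \sum_(s < n) h (side_vertex i j s.+1) (side_vertex i j s)).
Proof.
rewrite big_sumType; congr (_ + _).
  rewrite pair_bigA pair_bigA /=.
  under [RHS]eq_bigr => p _ do rewrite mulr_sumr.
  under [RHS]eq_bigr => p _ do under eq_bigr => a _ do rewrite mulr_sumr.
  under [RHS]eq_bigr => p _ do
    rewrite (sig_big_dep (fun _ => true) (fun _ _ => true)).
  rewrite pair_bigA /=; apply: eq_bigr => -[[[i j] l] [a b]] _ /=.
  by rewrite natrM mulrA.
rewrite pair_bigA /=.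
under [RHS]eq_bigr => p _ do rewrite mulrA mulr_sumr.
by rewrite pair_bigA /=; apply: eq_bigr => -[[i j] s] _ /=; rewrite natrM.
Qed.

Lemma face_point_rot i j l a b c : distinct3 i j l ->
  face_point j l i b c a = face_point i j l a b c.
Proof.
case/and3P => ij il jl; apply/ffunP => x; rewrite !ffunE; congr inord.
have [->|xi] := eqVneq x i; first by rewrite (negPf ij) (negPf il).
by case: eqVneq.
Qed.

Lemma face_point_side12 i j l s :
  face_point i j l s (n - s) 0 = side_vertex i j s.
Proof.
apply/ffunP => x; rewrite !ffunE; congr inord.
by case: (x == i); case: (x == j); case: (x == l).
Qed.

Lemma face_point_side23 i j l s : distinct3 i j l ->
  face_point i j l 0 s (n - s) = side_vertex j l s.
Proof.
by move=> ijl; rewrite -(face_point_rot _ _ _ ijl) face_point_side12.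
Qed.

Lemma face_point_side13 i j l s : distinct3 i j l -> (s <= n)%N ->
  face_point i j l s 0 (n - s) = side_vertex l i (n - s).
Proof.
move=> ijl sn; rewrite -(face_point_rot _ _ _ ijl).
have jli : distinct3 j l i.
  by case/and3P: ijl => ij il jl; rewrite /distinct3 jl !(eq_sym _ i) ij il.
by rewrite -(face_point_rot _ _ _ jli) -{2}(subKn sn) face_point_side12.
Qed.

Lemma side_vertex0 i j : i != j -> side_vertex i j 0 = corner j.
Proof.
move=> ij; apply/ffunP => x; rewrite !ffunE subn0; congr inord.
by have [->|xi] := eqVneq x i; [rewrite (negPf ij)|case: eqP].
Qed.

Lemma side_vertexn i j : side_vertex i j n = corner i.
Proof.
apply/ffunP => x; rewrite !ffunE subnn; congr inord.
by case: (x == i); case: (x == j).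
Qed.

End Instance.

(** * Counting labels and ordered triples *)

Lemma cut_map (S T : eqType) (f : S -> T) (p q : S) : cut (f p) (f q) <= cut p q.
Proof. by rewrite /cut; have [->|] := eqVneq p q; rewrite ?eqxx // lern1 leq_b1. Qed.

(** A value not met before can appear only across a cut edge. *)
Lemma cut_image (T : finType) (h : nat -> T) (n : nat) :
  (#|[set x | [exists s : 'I_n.+1, h s == x]]|)%:R <=
  1 + \sum_(s < n) cut (h s.+1) (h s).
Proof.
elim: n => [|n IH].
  rewrite big_ord0 addr0 (_ : [set _ | _] = [set h 0]) ?cards1 //.
  apply/setP => x; rewrite !inE; apply/existsP/eqP => [[s /eqP<-]|->].
    by rewrite ord1.
  by exists ord0.
set A := [set x | _] in IH; rewrite (_ : [set _ | _] = h n.+1 |: A).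
  rewrite cardsU1 natrD addrC big_ord_recr /= addrA lerD //.
  rewrite /cut; have [e|_] := eqVneq (h n.+1) (h n); last by rewrite lern1 leq_b1.
  suff -> : h n.+1 \in A by [].
  by rewrite inE; apply/existsP; exists ord_max; rewrite /= e.
apply/setP => x; rewrite !inE; apply/existsP/orP => [[s /eqP<-]|[/eqP->|]].
- have [sn|sn] := ltnP s n.+1; first by right; apply/existsP; exists (Ordinal sn).
  left; apply/eqP; congr h; apply/eqP.
  by rewrite eqn_leq sn andbT -ltnS ltn_ord.
- by exists ord_max.
- by case/existsP => s sx; exists (widen_ord (leqnSn _) s).
Qed.

Definition label_of (T : eqType) (i j l x : T) : label :=
  if x == i then One else if x == j then Two else if x == l then Three else Other.

Lemma distinct3_rot (T : eqType) (i j l : T) : distinct3 j l i = distinct3 i j l.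
Proof.
by rewrite /distinct3 (eq_sym j i) (eq_sym l i) andbC -andbA.
Qed.

Lemma sum_distinct3 (k : nat) (i j : 'I_k) :
  \sum_l (distinct3 i j l)%:R = (i != j)%:R * (k%:R - 2) :> int.
Proof.
rewrite /distinct3; have [->|ij] := eqVneq i j.
  by rewrite mul0r big1.
have := congr1 (fun s => s%:R : int) (sum1_card 'I_k).
rewrite /= card_ord natr_sum (bigD1 i) //= (bigD1 j) ?(eq_sym j) //= => <-.
rewrite mul1r big_mkcond [X in _ = X - _]addrA [X in X - _]addrC addrK /=.
rewrite [RHS]big_mkcond; apply: eq_bigr => l _.
by rewrite (eq_sym l i) (eq_sym l j); do 2 case: eqP.
Qed.

Lemma sum_neq (k : nat) (i : 'I_k) : \sum_j (i != j)%:R = k%:R - 1 :> int.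
Proof.
have := congr1 (fun s => s%:R : int) (sum1_card 'I_k).
rewrite /= card_ord natr_sum (bigD1 i) //= => <-.
rewrite addrAC subrr add0r [RHS]big_mkcond; apply: eq_bigr => l _.
by rewrite (eq_sym l i); case: eqP.
Qed.

Definition sum3 (T : finType) (h : T -> T -> T -> int) : int :=
  \sum_i \sum_j \sum_l (distinct3 i j l)%:R * h i j l.

Lemma sum3_rot (T : finType) (h : T -> T -> T -> int) :
  sum3 (fun i j l => h j l i) = sum3 h.
Proof.
rewrite /sum3 exchange_big; apply: eq_bigr => j _.
rewrite exchange_big; apply: eq_bigr => l _; apply: eq_bigr => i _.
by rewrite (distinct3_rot i).
Qed.

Lemma sum3_pair (T : finType) (h : T -> T -> T -> int) :
  sum3 h = \sum_(p : T * T * T)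
    (distinct3 p.1.1 p.1.2 p.2)%:R * h p.1.1 p.1.2 p.2.
Proof. by rewrite /sum3 pair_bigA pair_bigA. Qed.

Lemma sum3D (T : finType) (h h' : T -> T -> T -> int) :
  sum3 (fun i j l => h i j l + h' i j l) = sum3 h + sum3 h'.
Proof.
by rewrite !sum3_pair -big_split; apply: eq_bigr => p _; rewrite mulrDr.
Qed.

Lemma sum3Z (T : finType) (x : int) (h : T -> T -> T -> int) :
  sum3 (fun i j l => x * h i j l) = x * sum3 h.
Proof.
by rewrite !sum3_pair mulr_sumr; apply: eq_bigr => p _; rewrite mulrCA.
Qed.

Lemma ler_sum3 (T : finType) (h h' : T -> T -> T -> int) :
  (forall i j l, distinct3 i j l -> h i j l <= h' i j l) -> sum3 h <= sum3 h'.
Proof.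
move=> hh; rewrite !sum3_pair; apply: ler_sum => p _.
by case: distinct3 (hh p.1.1 p.1.2 p.2) => [hp|_]; rewrite ?mul1r ?mul0r ?hp.
Qed.

Lemma sum3_1 (k : nat) :
  sum3 (fun _ _ _ : 'I_k => 1) = k%:R * (k%:R - 1) * (k%:R - 2).
Proof.
rewrite /sum3; under eq_bigr => i _ do under eq_bigr => j _ do
  (under eq_bigr do rewrite mulr1; rewrite sum_distinct3).
under eq_bigr do rewrite -mulr_suml sum_neq.
by rewrite sumr_const card_ord -[LHS]mulr_natl mulrA.
Qed.

(** * Lower bound on integral cuts *)

Section Bounds.
Variables (m k : nat).

Local Notation n := (3 * m + 2)%N.
Local Notation N := (3 * m + 1)%N.

Section CutBound.
Variable P : grid m k -> 'I_k.
Hypothesis P_corner : forall i, P (corner m i) = i.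

Let meets (i j l : 'I_k) : bool :=
  [exists s : 'I_n.+1, P (side_vertex m i j s) == l].

Let face_cut i j l := tri_sum N (fun a b c => (edge_weight m a b c)%:R *
  cut (P (face_point m i j l a.+1 b c)) (P (face_point m i j l a b.+1 c))).

Let side_cut i j :=
  \sum_(s < n) cut (P (side_vertex m i j s.+1)) (P (side_vertex m i j s)).

(** Each rotation of the triple supplies one edge of every upward triangle of the face, and
    [label_of] only merges labels, which cannot raise the cut. *)
Lemma face_cut_bound i j l : distinct3 i j l ->
  (6 * m.+1)%:R - (2 * m.+1)%:R *
    ((meets j l i)%:R + (meets l i j)%:R + (meets i j l)%:R) <=
  face_cut i j l + face_cut j l i + face_cut l i j.
Proof.
move=> ijl; have [ij il jl] := and3P ijl.
have jli : distinct3 j l i by rewrite distinct3_rot.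
have lij : distinct3 l i j by rewrite distinct3_rot.
pose F a b c := label_of i j l (P (face_point m i j l a b c)).
have meetsP u v w s : (s <= n)%N -> P (side_vertex m u v s) = w -> meets u v w.
  by move=> sn Ps; apply/existsP; exists (Ordinal (sn : s < n.+1)%N); apply/eqP.
have FOne a b c : F a b c = One -> P (face_point m i j l a b c) = i.
  by rewrite /F /label_of; case: eqP => //; case: eqP => //; case: eqP.
have FTwo a b c : F a b c = Two -> P (face_point m i j l a b c) = j.
  by rewrite /F /label_of; case: eqP => //; case: eqP => //; case: eqP.
have FThree a b c : F a b c = Three -> P (face_point m i j l a b c) = l.
  by rewrite /F /label_of; case: eqP => //; case: eqP => //; case: eqP.
have := @face_bound m F (meets j l i) (meets l i j) (meets i j l).
have -> : F n 0 0 = One.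
  have e := face_point_side12 m i j l n; rewrite subnn side_vertexn in e.
  by rewrite /F e P_corner /label_of eqxx.
have -> : F 0 n 0 = Two.
  have e := @face_point_side23 m _ i j l n ijl; rewrite subnn side_vertexn in e.
  by rewrite /F e P_corner /label_of eq_sym (negPf ij) eqxx.
have -> : F 0 0 n = Three.
  have e := @face_point_side23 m _ i j l 0 ijl; rewrite subn0 side_vertex0 // in e.
  by rewrite /F e P_corner /label_of ![l == _]eq_sym (negPf il) (negPf jl) eqxx.
move=> /(_ erefl erefl erefl) fb.
rewrite -!natrD -natrM; apply: le_trans (fb _ _ _) _ => {fb}.
- by move=> s sn /FOne; rewrite face_point_side23 //; apply: meetsP.
- by move=> s sn /FTwo; rewrite face_point_side13 //; apply: meetsP; lia.
- by move=> s sn /FThree; rewrite face_point_side12; apply: meetsP.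
rewrite /face_cut (tri_sum_rot N (fun a b c => _ * cut (P (face_point m j l i _ _ _)) _)).
rewrite 2!(tri_sum_rot N (fun a b c => _ * cut (P (face_point m l i j _ _ _)) _)).
rewrite -!tri_sumD; apply: ler_tri_sum => a b c _.
rewrite !(face_point_rot _ _ _ _ lij) !(face_point_rot _ _ _ _ jli)
  !(face_point_rot _ _ _ _ ijl).
have cutF p q : cut (label_of i j l p) (label_of i j l q) <= cut p q.
  exact: cut_map.
by rewrite /F !lerD // ler_wpM2l ?ler0n ?cutF.
Qed.

Lemma side_cut_bound i j : i != j ->
  1 + \sum_l (distinct3 i j l)%:R * (meets i j l)%:R <= side_cut i j.
Proof.
move=> ij.
have := @cut_image _ (fun s => P (side_vertex m i j s)) n.
rewrite -/(side_cut i j) -sum1_card natr_sum big_mkcond /=.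
rewrite (bigD1 i) //= (bigD1 j) 1?eq_sym //= !inE.
have -> : [exists s : 'I_n.+1, P (side_vertex m i j s) == i].
  by apply/existsP; exists ord_max; rewrite side_vertexn P_corner.
have -> : [exists s : 'I_n.+1, P (side_vertex m i j s) == j].
  by apply/existsP; exists ord0; rewrite side_vertex0 ?P_corner.
rewrite lerD2l; apply: le_trans; rewrite lerD2l [X in _ <= X]big_mkcond.
apply: ler_sum => l _; rewrite /distinct3 ij inE -/(meets i j l).
rewrite (eq_sym l i) (eq_sym l j).
by case: (i == l); case: (j == l); case: (meets i j l).
Qed.

(** Over all ordered triples the faces lose [2 * m.+1] for each triple whose label [l] occurs on the
    side from [i] to [j]. The side gadgets, of weight [2 * m.+1], regain exactly this. Per ordered
    pair there remain [k - 2] from the faces and 1 from the side. *)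
Lemma total_cut_bound :
  (2 * m.+1)%:R * (k%:R * (k%:R - 1) ^+ 2) <=
  \sum_g (gadget_weight g)%:R * cut (P (gadget_src g)) (P (gadget_dst g)) :> int.
Proof.
rewrite (gadget_sumE (fun u v => cut (P u) (P v))).
set A := (X in _ <= X + _); set B := (X in _ <= _ + X).
have AE : A = sum3 face_cut by [].
pose mts i j l : int := (meets i j l)%:R.
have faces : sum3 (fun i j l => (6 * m.+1)%:R * 1 +
    - (2 * m.+1)%:R * (mts j l i + mts l i j + mts i j l)) <=
    sum3 (fun i j l => face_cut i j l + face_cut j l i + face_cut l i j).
  apply: ler_sum3 => i j l ijl; rewrite mulr1 mulNr; exact: face_cut_bound.
have rot2 h : sum3 (fun i j l : 'I_k => h l i j) = sum3 h.
  by rewrite (sum3_rot (fun i j l => h j l i)) sum3_rot.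
rewrite !sum3D !sum3Z !sum3D sum3_1 !(sum3_rot mts) !(rot2 mts)
  !(sum3_rot face_cut) !(rot2 face_cut) -AE in faces.
have sides : (2 * m.+1)%:R * (k%:R * (k%:R - 1) + sum3 mts) <= B.
  have -> : k%:R * (k%:R - 1) + sum3 mts =
      \sum_i \sum_j (i != j)%:R * (1 + \sum_l (distinct3 i j l)%:R * mts i j l).
    have -> : k%:R * (k%:R - 1) = \sum_(i < k) \sum_(j < k) (i != j)%:R :> int.
      by under eq_bigr do rewrite sum_neq; rewrite sumr_const card_ord mulr_natl.
    rewrite -big_split; apply: eq_bigr => i _.
    rewrite -big_split; apply: eq_bigr => j _ /=.
    have [ij|ij] := eqVneq i j; last by rewrite !mul1r.
    by rewrite /distinct3 ij eqxx mul0r add0r big1 // => l _; rewrite mul0r.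
  rewrite mulr_sumr; apply: ler_sum => i _.
  rewrite mulr_sumr; apply: ler_sum => j _; rewrite mulrCA.
  have [ij|ij] := eqVneq i j; first by rewrite !mul0r.
  by rewrite !mul1r ler_wpM2l ?ler0n ?side_cut_bound.
have e6 : (6 * m.+1)%:R = 3 * (2 * m.+1)%:R :> int by rewrite -natrM mulnA.
rewrite e6 in faces.
have -> : k%:R * (k%:R - 1) ^+ 2 =
    k%:R * (k%:R - 1) * (k%:R - 2) + k%:R * (k%:R - 1) :> int by ring.
lra.
Qed.

End CutBound.
End Bounds.

(** * The fractional solution and bounds on both optima *)

Section LP.
Variables (R : realType) (m k : nat).
Hypothesis k3 : (3 <= k)%N.

Local Notation n := (3 * m + 2)%N.
Local Notation N := (3 * m + 1)%N.

Let i0 : 'I_k := Ordinal (leq_trans (isT : 0 < 3)%N k3).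
Let i1 : 'I_k := Ordinal (leq_trans (isT : 1 < 3)%N k3).

Definition gap_instance : multiway_cut R k :=
  gadget_instance R (@gadget_weight m k) (@gadget_src m k) (@gadget_dst m k)
    (@corner_inj m k).

Lemma face_pointE (i j l : 'I_k) a b c x :
  i != j -> (a + b + c = n)%N -> distinct3 i j l || (c == 0)%N ->
  face_point m i j l a b c x = ((x == i) * a + (x == j) * b + (x == l) * c)%N :> nat.
Proof.
move=> ij abc h; rewrite ffunE inordK; last first.
  by case: (x == i); case: (x == j); case: (x == l); lia.
have jl : ((j == l) * c = 0)%N.
  by case/orP: h => [/and3P[_ _ /negPf e]|/eqP->]; rewrite ?muln0 // e.
have il : ((i == l) * c = 0)%N.
  by case/orP: h => [/and3P[_ /negPf e _]|/eqP->]; rewrite ?muln0 // e.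
have [->|xi] := eqVneq x i; first by rewrite (negPf ij) il; lia.
by have [->|xj] := eqVneq x j; [rewrite jl|case: (x == l)]; lia.
Qed.

Lemma face_point_sum (i j l : 'I_k) a b c :
  i != j -> (a + b + c = n)%N -> distinct3 i j l || (c == 0)%N ->
  (\sum_x face_point m i j l a b c x = n)%N.
Proof.
move=> ij abc h; under eq_bigr do rewrite face_pointE //.
have s1 (y : 'I_k) d : (\sum_x (x == y) * d = d)%N.
  rewrite (bigD1 y) //= eqxx mul1n big1 ?addn0 // => x.
  by move/negPf->.
by rewrite !big_split /= !s1.
Qed.

(** Grid points outside the simplex are sent to an arbitrary terminal, as they touch no gadget of
    positive weight. *)
Definition fractional (u : grid m k) : 'rV[R]_k :=
  if (\sum_x u x == n)%N then \row_x ((u x)%:R / n%:R) else delta_mx 0 i0.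

Lemma n_gt0 : 0 < n%:R :> R.
Proof. by rewrite ltr0n addn2. Qed.

Lemma sum_delta (i : 'I_k) (x : R) : \sum_j (j == i)%:R * x = x.
Proof.
rewrite (bigD1 i) //= eqxx mul1r big1 ?addr0 // => j /negPf->.
by rewrite mul0r.
Qed.

Lemma cornerE (i x : 'I_k) : corner m i x = ((x == i) * n)%N :> nat.
Proof.
by rewrite ffunE inordK; case: (x == i); rewrite /= ?mul1n // ltnS.
Qed.

Lemma fractional_corner (i : 'I_k) : fractional (corner m i) = delta_mx 0 i.
Proof.
rewrite /fractional ifT; last first.
  under eq_bigr do rewrite cornerE.
  by rewrite (bigD1 i) //= eqxx mul1n big1 ?addn0 // => x /negPf->.
apply/rowP => x; rewrite !mxE cornerE eqxx /=.
by case: (x == i); rewrite ?mul1n ?mul0n ?mul0r // divff // gt_eqF ?n_gt0.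
Qed.

Lemma fractional_simplex u : simplex (fractional u).
Proof.
rewrite /fractional; case: eqP => [su|_]; split.
- move=> i; rewrite mxE divr_ge0 ?ler0n //= ler_pdivrMr ?n_gt0 //.
  by rewrite mul1r ler_nat -ltnS ltn_ord.
- under eq_bigr do rewrite mxE.
  by rewrite -mulr_suml -natr_sum su divff // gt_eqF ?n_gt0.
- by move=> i; rewrite mxE ler0n lern1 leq_b1.
- under eq_bigr do rewrite mxE /= -[_%:R]mulr1.
  exact: sum_delta.
Qed.

Lemma fractional_feasible : ckr_feasible (I := gap_instance) fractional.
Proof. by split=> [u|i]; [exact: fractional_simplex|exact: fractional_corner]. Qed.

Lemma fractional_arc (i j l : 'I_k) a b c :
  i != j -> (a + b + c = N)%N -> distinct3 i j l || (c == 0)%N ->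
  2^-1 * l1_norm (fractional (face_point m i j l a.+1 b c) -
                  fractional (face_point m i j l a b.+1 c)) <= n%:R^-1.
Proof.
move=> ij abc h.
have abc1 : (a.+1 + b + c = n)%N by lia.
have abc2 : (a + b.+1 + c = n)%N by lia.
rewrite /fractional !face_point_sum // eqxx.
rewrite mulrC ler_pdivrMr ?ltr0n //.
rewrite mulr_natr mulr2n.
have -> : n%:R^-1 + n%:R^-1 =
    \sum_(x < k) ((x == i)%:R / n%:R + (x == j)%:R / n%:R) :> R.
  by rewrite big_split /= !sum_delta.
apply: ler_sum => x _ /=; rewrite !mxE !face_pointE // -mulrBl.
rewrite normrM [`|n%:R^-1|]gtr0_norm ?invr_gt0 ?n_gt0 // -mulrDl.
rewrite ler_wpM2r ?invr_ge0 ?ler0n // !mulnS !natrD !opprD.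
rewrite (_ : _ + _ = (x == i)%:R - (x == j)%:R); last by ring.
by apply: le_trans (ler_normB _ _) _; rewrite !normr_nat.
Qed.

Lemma ckr_cost_fractional :
  ckr_cost (I := gap_instance) fractional <=
  (\sum_(g : gadget m k) (gadget_weight g)%:R) / n%:R.
Proof.
rewrite gadget_ckr_cost mulr_suml; apply: ler_sum => g _.
case: g => [[[[i j] l] [a b]]|[[i j] s]] /=.
  have [ijl|_] := boolP (distinct3 i j l); last by rewrite !mul0r.
  rewrite ler_wpM2l ?ler0n // fractional_arc ?ijl //; first by case/and3P: ijl.
  by have := ltn_ord a; have := ltn_ord b; lia.
have [->|ij] := eqVneq i j; first by rewrite !mul0r.
rewrite ler_wpM2l ?ler0n // /side_vertex.
have sn := ltn_ord s; rewrite -[(n - s)%N](@subnSK) // fractional_arc ?orbT //.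
by lia.
Qed.

Lemma total_weight :
  \sum_(g : gadget m k) (gadget_weight g)%:R <=
  k%:R * (k%:R - 1) * ((k%:R - 2) * (5 * m.+1 ^ 2 + 4 * m.+1)%:R +
    (2 * m.+1 * n)%:R) :> int.
Proof.
under eq_bigr do rewrite -[_%:R]mulr1.
rewrite (gadget_sumE (fun _ _ => 1)).
set S := tri_sum N _.
have S_le : S <= (5 * m.+1 ^ 2 + 4 * m.+1)%:R.
  by apply: le_trans (edge_weight_sum m); apply: ler_tri_sum => *; rewrite mulr1.
rewrite -[X in X + _ <= _]/(sum3 (fun _ _ _ => S)).
have -> : sum3 (fun _ _ _ : 'I_k => S) = S * (k%:R * (k%:R - 1) * (k%:R - 2)).
  by rewrite -sum3_1 -sum3Z mulr1.
under [X in _ + X]eq_bigr do rewrite -mulr_suml sum_neq.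
rewrite !sumr_const !card_ord -mulr_natl -natrM.
have k2 : 0 <= k%:R - 2 :> int by lia.
have k1 : 0 <= k%:R * (k%:R - 1) :> int.
  by rewrite mulr_ge0 //; lia.
have := ler_wpM2l (mulr_ge0 k1 k2) S_le.
lra.
Qed.

Lemma ler_l1_norm (v : 'rV[R]_k) (i : 'I_k) : `|v 0 i| <= l1_norm v.
Proof. by rewrite /l1_norm (bigD1 i) //= lerDl; apply: sumr_ge0. Qed.

(** Along the side joining two terminals, coordinate [i0] telescopes from 0 to 1, and the edges
    there have weight at least [2 * m.+1]. This crude bound serves to make the infimum genuine and
    positive. *)
Lemma ckr_cost_ge1 x : ckr_feasible (I := gap_instance) x ->
  1 <= ckr_cost (I := gap_instance) x.
Proof.
case=> _ xt; rewrite gadget_ckr_cost.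
have l1_ge0 (v : 'rV[R]_k) : 0 <= l1_norm v by apply: sumr_ge0.
pose h u v := 2^-1 * l1_norm (x u - x v).
have h_ge0 u v : 0 <= h u v by rewrite mulr_ge0 ?invr_ge0 ?ler0n.
rewrite (gadget_sumE h).
have path : 2^-1 <= \sum_(s < n) h (side_vertex m i0 i1 s.+1) (side_vertex m i0 i1 s).
  rewrite -mulr_sumr ler_pMr ?invr_gt0 ?ltr0n //.
  pose y s := x (side_vertex m i0 i1 s) 0 i0.
  apply: (@le_trans _ _ (\sum_(s < n) `|y s.+1 - y s|)); last first.
    apply: ler_sum => s _; apply: le_trans (ler_l1_norm _ i0).
    by rewrite !mxE.
  apply: le_trans (ler_norm_sum _ _ _).
  rewrite -(big_mkord xpredT (fun s => y s.+1 - y s)) telescope_sumr //.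
  rewrite /y side_vertexn side_vertex0 //.
  rewrite (xt i0) (xt i1) !mxE /= subr0.
  by rewrite normr1.
apply: le_trans (_ : (2 * m.+1)%:R * 2^-1 <= _).
  by rewrite natrM mulrAC divff ?pnatr_eq0 // mul1r ler1n.
rewrite -[X in X <= _]add0r; apply: lerD.
  do 3 (apply: sumr_ge0 => ? _); rewrite mulr_ge0 //.
  by do 2 (apply: sumr_ge0 => ? _); rewrite mulr_ge0.
rewrite (bigD1 i0) //= (bigD1 i1) //= mul1r -addrA.
apply: ler_wpDr; last by rewrite ler_wpM2l.
have side_ge0 i j : 0 <= (i != j)%:R * ((2 * m.+1)%:R *
    \sum_(s < n) h (side_vertex m i j s.+1) (side_vertex m i j s)).
  by rewrite !mulr_ge0 //; apply: sumr_ge0.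
by rewrite addr_ge0 //; do ?[apply: sumr_ge0 => ? _].
Qed.

Lemma integral_opt_ge :
  (2 * m.+1)%:R * (k%:R * (k%:R - 1) ^+ 2) <= integral_opt gap_instance.
Proof.
apply: lb_le_inf.
  (* The infimum needs one feasible partition; all points but the corners may go anywhere. *)
  pose P : {ffun grid m k -> 'I_k} :=
    [ffun v => odflt i0 [pick i | corner m i == v]].
  exists (cut_cost (I := gap_instance) P); exists P => // i.
  rewrite ffunE; case: pickP => [j /eqP/corner_inj|/(_ i)] //=.
  by rewrite eqxx.
move=> _ [P Pt <-]; rewrite gadget_cut_cost.
have := total_cut_bound Pt; rewrite -(ler_int R); apply: le_trans.
by rewrite !(rmorphM, rmorphXn, rmorphB) /= !natz.
Qed.

Lemma ckr_opt_ge1 : 1 <= ckr_opt gap_instance.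
Proof.
apply: lb_le_inf; last by move=> _ [x xf <-]; apply: ckr_cost_ge1.
exists (ckr_cost (I := gap_instance) fractional).
by exists fractional => //; apply: fractional_feasible.
Qed.

Lemma ckr_opt_le : ckr_opt gap_instance <=
  (k%:R * (k%:R - 1) * ((k%:R - 2) * (5 * m.+1 ^ 2 + 4 * m.+1)%:R +
    (2 * m.+1 * n)%:R)) / n%:R.
Proof.
apply: (@le_trans _ _ (ckr_cost (I := gap_instance) fractional)).
  apply: ge_inf; last by exists fractional => //; apply: fractional_feasible.
  by exists 1 => _ [x xf <-]; apply: ckr_cost_ge1.
apply: le_trans ckr_cost_fractional _; rewrite ler_pM2r ?invr_gt0 ?n_gt0 //.
have := total_weight; rewrite -(ler_int R) rmorph_sum /=.
under eq_bigr do rewrite rmorph_nat.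
move/le_trans; apply.
by rewrite !(rmorphM, rmorphD, rmorphB, rmorph_nat, rmorph1).
Qed.

End LP.

(** * Choice of the grid size and final estimate *)

Theorem theorem1 (R : realType) (k : nat) (eps : R) (hk : (3 <= k)%N)
    (heps : 0 < eps) :
  exists I : multiway_cut R k,
    0 < ckr_opt I /\
    6 / (5 + 1 / (k%:R - 1)) - eps <= integrality_gap I.
Proof.
(* The constant 7 is chosen for [2 * 17 * (K - 2) <= 7 * (5 * K - 4)], which bounds the error term
   by means of [A <= 2]. *)
pose m := Num.bound (7 / eps).
have bound_m : 7 / eps < m%:R by rewrite archi_boundP // divr_ge0 // ltW.
have opt_gt0 := lt_le_trans ltr01 (ckr_opt_ge1 R m hk).
exists (gap_instance R m k); split=> //.
rewrite /integrality_gap ler_pdivlMr //.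
apply: le_trans (integral_opt_ge R m hk).
set K : R := k%:R; set n : R := (3 * m + 2)%:R.
have K3 : 3 <= K by rewrite ler_nat.
have n_gt0 : 0 < n by rewrite ltr0n addn2.
have eps_n : 7 <= eps * n.
  rewrite mulrC -ler_pdivrMr //; apply: ltW; apply: lt_trans bound_m _.
  by rewrite ltr_nat; lia.
have [neg|/ltW pos] := leP (6 / (5 + 1 / (K - 1)) - eps) 0.
  apply: (@le_trans _ _ 0); first by rewrite mulr_le0_ge0 // ltW.
  by rewrite !mulr_ge0 ?exprn_ge0 ?ler0n //; lra.
apply: le_trans (ler_wpM2l pos (ckr_opt_le R m hk)) _.
rewrite -/K -/n [leLHS]mulrA ler_pdivrMr //.
set M : R := m.+1%:R.
have nM : n = 3 * M - 1.
  by rewrite /n /M -addn1 !natrD natrM; ring.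
have M0 : 0 < M by rewrite ltr0n.
have -> : (5 * m.+1 ^ 2 + 4 * m.+1)%:R = 5 * M ^+ 2 + 4 * M :> R.
  by rewrite natrD !natrM expr2.
have -> : (2 * m.+1 * (3 * m + 2))%:R = 2 * M * n :> R by rewrite !natrM.
have -> : (2 * m.+1)%:R = 2 * M :> R by rewrite natrM.
set A := 6 / _ in pos *.
have q0 : 0 < 5 * K - 4 by lra.
have AE : A * (5 * K - 4) = 6 * (K - 1).
  by rewrite /A; field; rewrite !gt_eqF //; lra.
have A2 : A <= 2.
  by rewrite -(ler_pM2r q0) AE; lra.
suff main : (A - eps) * ((K - 2) * (5 * M + 4) + 2 * n) <= 2 * (K - 1) * n.
  have MK : 0 <= M * K * (K - 1) by rewrite !mulr_ge0 //; lra.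
  have := ler_wpM2l MK main.
  rewrite (_ : _ * (_ * _) = (A - eps) * (K * (K - 1) *
    ((K - 2) * (5 * M ^+ 2 + 4 * M) + 2 * M * n))); last by ring.
  by move/le_trans; apply; rewrite le_eqVlt; apply/orP; left; apply/eqP; ring.
(* Since [3 * M = n + 1], three times the second factor of [main] is
   [(5 * K - 4) * n + 17 * (K - 2)]. By [AE] the first summand matches the right-hand side exactly;
   [eps] absorbs the second. *)
have Ad : A * (17 * (K - 2)) <= eps * n * (5 * K - 4).
  apply: (@le_trans _ _ (2 * (17 * (K - 2)))); first by rewrite ler_wpM2r //; lra.
  by apply: le_trans (ler_wpM2r (ltW q0) eps_n); lra.
rewrite -(ler_pM2l (_ : 0 < 3)) //.
rewrite (_ : 3 * _ = A * (5 * K - 4) * n + A * (17 * (K - 2))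
  - eps * n * (5 * K - 4) - eps * (17 * (K - 2))); last by rewrite nM; ring.
rewrite AE.
have : 0 <= eps * (17 * (K - 2)) by rewrite mulr_ge0 ?ltW //; lra.
lra.
Qed.
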